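(* Let $n\ge1$ and let $\lambda$ be a partition of $n$. Then the character of $\mathbb{C}^*$ on the tangent space to the Schubert cell $\mathrm{Sch}_\lambda$ at its fixed point $W_\lambda$ is $$ch(T_{W_\lambda}\mathrm{Sch}_\lambda)=\sum_{u\in\lambda}q^{-h_\lambda(u)},$$ where the sum is over the boxes $u$ of the Young diagram of $\lambda$ and $h_\lambda(u)$ is the hook length of $u$.
   Context: Let $\mathrm{Gr}(n)$ be the Grassmannian of $n$-dimensional subspaces of $\mathbb{C}[z]/(z^{2n})$, with the complete flag formed by the subspaces $(z^j)/(z^{2n})$. For a partition $\lambda=(l_1,\dots,l_n)$, $0\le l_1\le\dots\le l_n$, $l_1+\dots+l_n=n$, the Schubert cell $\mathrm{Sch}_\lambda\subset\mathrm{Gr}(n)$ is the set of $W$ whose nonzero elements have set of orders of vanishing at $z=0$ equal to $\{2n-l_i-i:1\le i\le n\}$. The group $\mathbb{C}^*$ acts on $\mathbb{C}[z]$ by $(c,z^i)\mapsto c^{-i}z^i$; the induced action on $\mathrm{Gr}(n)$ preserves $\mathrm{Sch}_\lambda$ and contracts it to the unique fixed point $W_\lambda=\langle z^{2n-l_1-1},z^{2n-l_2-2},\dots,z^{2n-l_n-n}\rangle$. The symbol $q^i$ denotes the character $c\mapsto c^i$ of $\mathbb{C}^*$, and $ch\,V=\sum_i\dim V_i\,q^i$ for a finite-dimensional $\mathbb{C}^*$-module $V$ with weight spaces $V_i$. *)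

(* Defs.v *)
From HB Require Import structures.
From mathcomp Require Import all_boot all_order all_algebra.
From mathcomp Require Import mathcomp_extra boolp classical_sets functions.
From mathcomp Require Import cardinality fsbigop reals.
From mathcomp Require Import complex.
From mathcomp Require mpoly.
Set Implicit Arguments.
Unset Strict Implicit.
Unset Printing Implicit Defensive.
Import Order.TTheory GRing.Theory Num.Theory.
Local Open Scope classical_set_scope.
Local Open Scope ring_scope.

Section VspaceOf.
Variables (K : fieldType) (E : vectType K).

(* The subspace whose vectors are those satisfying [P]; the default value 0 is
   never used when [P] is closed under linear combinations (mem_vspace_of). *)
Definition vspace_of (P : set E) : {vspace E} :=
  xget 0%VS [set U : {vspace E} | forall v, v \in U <-> P v].

Lemma mem_vspace_of (P : set E) :
  P 0 -> (forall a u v, P u -> P v -> P (a *: u + v)) ->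
  forall v, v \in vspace_of P <-> P v.
Proof.
move=> P0 PD.
suff [U PU] : exists U : {vspace E}, forall v, v \in U <-> P v.
  exact: (@xgetPex _ 0%VS [set U : {vspace E} | forall v, v \in U <-> P v]
            (ex_intro _ U PU)).
pose Q k := `[< exists2 U : {vspace E}, {in U, forall v, P v} & \dim U = k >].
have exQ : exists k, Q k.
  exists 0%N; apply/asboolP; exists 0%VS; last exact: dimv0.
  by move=> v; rewrite memv0 => /eqP->.
have leQ k : Q k -> (k <= \dim {:E})%N.
  by move=> /asboolP[U _ <-]; apply/dimvS/subvf.
case: (ex_maxnP exQ leQ) => k /asboolP[U UP dU] maxk.
exists U => v; split=> [/UP//|Pv]; apply: contrapT => /negP vU.
have : Q (\dim (<[v]> + U)%VS).
  apply/asboolP; exists (<[v]> + U)%VS => //.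
  by move=> w /memv_addP[_ /vlineP[a ->]] [u /UP uP ->]; apply: PD.
move=> /maxk; rewrite -dU => le_dim; case/negP: vU.
have /eqP -> : U == (<[v]> + U)%VS by rewrite eqEdim addvSr.
by apply: (subvP (addvSl _ _)); apply: memv_line.
Qed.

End VspaceOf.

Section ZariskiTangent.
Variables (K : fieldType) (E : vectType K).

Definition coords (x : E) (i : 'I_(\dim {:E})) : K := coord (vbasis {:E}) i x.

(* Zariski tangent space at [x] of a (locally closed) subset [X] of the affine
   space [E]: the common zeros of the differentials at [x] of all the
   polynomial functions that vanish on [X]. *)
Definition zariski_tangent (X : set E) (x : E) : set E :=
  [set v | forall p : mpoly.mpoly (\dim {:E}) K,
     (forall y, X y -> mpoly.meval (coords y) p = 0) ->
     \sum_i mpoly.meval (coords x) (mpoly.mderiv i p) * coords v i = 0].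

Lemma zariski_tangent_linear X x a u v :
  zariski_tangent X x u -> zariski_tangent X x v ->
  zariski_tangent X x (a *: u + v).
Proof.
move=> Tu Tv p Xp.
rewrite (eq_bigr (fun i =>
    a * (mpoly.meval (coords x) (mpoly.mderiv i p) * coords u i) +
    mpoly.meval (coords x) (mpoly.mderiv i p) * coords v i)).
  by rewrite big_split -mulr_sumr /= Tu // Tv // mulr0 addr0.
by move=> i _; rewrite /coords linearP mulrDr mulrCA.
Qed.

Lemma zariski_tangent0 X x : zariski_tangent X x 0.
Proof. by move=> p _; apply: big1 => i _; rewrite /coords linear0 mulr0. Qed.

End ZariskiTangent.

Section Character.
Variables (K : fieldType) (E : vectType K).
Variables (T : {vspace E}) (rho : K -> E -> E).

(* [rho c] is only relevant for [c != 0]: it is an action of the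
   multiplicative group of [K]. *)
Definition weight_space (k : int) : {vspace E} :=
  vspace_of [set v | v \in T /\ forall c, c != 0 -> rho c v = c ^ k *: v].

Lemma mem_weight_space k : (forall c, linear (rho c)) -> forall v,
  v \in weight_space k <->
  (v \in T /\ forall c, c != 0 -> rho c v = c ^ k *: v).
Proof.
move=> rhoL; apply: mem_vspace_of => [|a u v [uT uk] [vT vk]] /=.
  split; first exact: mem0v.
  move=> c _; have := rhoL c (-1) 0 0.
  by rewrite !scaler0 addr0 scaleN1r addNr.
split=> [|c c0]; first by rewrite memvD ?memvZ.
by rewrite rhoL uk // vk // scalerDr !scalerA mulrC.
Qed.

(* Characters are Laurent polynomials in [q]; Z[q, q^-1] is viewed inside the
   fraction field of Z[q]. *)
Definition q : {fraction {poly int}} := FracField.tofrac 'X.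

Definition ch : {fraction {poly int}} :=
  \sum_(k \in [set: int]) q ^ k *+ \dim (weight_space k).

End Character.

Section GrassmannianChart.
Variables (K : fieldType) (V : vectType K).

Definition Gr (n : nat) : set {vspace V} := [set W | \dim W = n].

(* When [W] and [U] are complementary, [graph] is the standard affine chart
   of the Grassmannian centred at [W], and its domain Hom(W, U) is
   Hom(W, V/W), the tangent space of the Grassmannian at [W]. *)
Definition graph (W U : {vspace V}) (phi : 'Hom(subvs_of W, subvs_of U)) :
    {vspace V} :=
  limg (linfun vsval + (linfun vsval \o phi))%VF.

Definition tangent_space (W U : {vspace V}) (X : set {vspace V}) :
    {vspace 'Hom(subvs_of W, subvs_of U)} :=
  vspace_of (zariski_tangent [set phi | X (graph phi)] 0).

(* The action on Hom(W, V/W) of an automorphism [g] of [V] that preserves [W]: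
   phi is mapped to g \o phi \o g^-1, where [U] is identified with V/W. *)
Definition hom_act (W U : {vspace V}) (g : 'End(V))
    (phi : 'Hom(subvs_of W, subvs_of U)) : 'Hom(subvs_of W, subvs_of U) :=
  (linfun (vsproj U) \o daddv_pi U W \o g \o linfun vsval \o phi
     \o linfun (vsproj W) \o g^-1 \o linfun vsval)%VF.

Lemma hom_act_linear (W U : {vspace V}) (g : 'End(V)) :
  linear (@hom_act W U g).
Proof.
by move=> a phi psi; rewrite /hom_act comp_lfunDr -comp_lfunZr
  !comp_lfunDl -!comp_lfunZl.
Qed.

(* When the complement [U] is stable too, [hom_act] is the action on the
   Grassmannian read in the chart; being linear, it is its own differential. *)
Lemma graph_hom_act (W U : {vspace V}) (g : 'End(V)) :
  (W :&: U = 0)%VS -> lker g == 0%VS ->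
  (g @: W <= W)%VS -> (g @: U <= U)%VS ->
  forall phi : 'Hom(subvs_of W, subvs_of U),
  graph (hom_act g phi) = (g @: graph phi)%VS.
Proof.
move=> WU kg gW gU phi.
have {}gW : (g @: W = W)%VS.
  have dW : \dim (g @: W) = \dim W.
    by apply: limg_dim_eq; rewrite (eqP kg) capv0.
  by apply/eqP; rewrite eqEdim gW dW leqnn.
have g'gK v : (g^-1)%VF (g v) = v by rewrite lker0_lfunK.
have key (w w' : subvs_of W) : vsval w = g (vsval w') ->
    vsval (hom_act g phi w) = g (vsval (phi w')).
  move=> wE; rewrite /hom_act !comp_lfunE /= !lfunE /= wE g'gK vsvalK.
  have inU : g (vsval (phi w')) \in U.
    by apply: (subvP gU); rewrite memv_img ?subvsP.
  by rewrite daddv_pi_id ?vsprojK // capvC.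
have gE (psi : 'Hom(subvs_of W, subvs_of U)) (w : subvs_of W) :
    (linfun vsval + (linfun vsval \o psi))%VF w = vsval w + vsval (psi w).
  by rewrite add_lfunE comp_lfunE 2!lfunE.
apply/vspaceP => v; apply/idP/idP.
- move=> /memv_imgP[w _ ->]; rewrite gE.
  have: vsval w \in (g @: W)%VS by rewrite gW subvsP.
  move=> /memv_imgP[x xW wE].
  have wE' : vsval w = g (vsval (vsproj W x)) by rewrite vsprojK.
  rewrite (key _ _ wE') wE' -linearD memv_img //.
  by apply/memv_imgP; exists (vsproj W x); rewrite ?memvf ?gE.
- move=> /memv_imgP[_ /memv_imgP[w' _ ->] ->].
  rewrite gE linearD.
  have gw : g (vsval w') \in W by rewrite -{2}gW memv_img ?subvsP.
  apply/memv_imgP; exists (vsproj W (g (vsval w'))); first exact: memvf.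
  by rewrite gE (key _ w') ?vsprojK.
Qed.

End GrassmannianChart.

Section SchubertCell.
Variables (R : realType) (n : nat).

Definition V := {poly %/ ('X^(2 * n)%N : {poly R[i]})}.

Definition zpow (j : nat) : V := in_qpoly 'X^(2 * n)%N 'X^j.

(* order of vanishing at z = 0 of (the representative of degree < 2n of) v *)
Definition ord_van (v : V) : nat := mup 0 (v : {poly R[i]}).

Definition act_fun (c : R[i]) (v : V) : V :=
  \sum_(i < (2 * n)%N) (c ^- i * (v : {poly R[i]})`_i) *: zpow i.

Lemma act_fun_linear c : linear (act_fun c).
Proof.
move=> a u v; rewrite /act_fun scaler_sumr -big_split /=.
apply: eq_bigr => i _.
by rewrite coefD coefZ mulrDr scalerDl scalerA mulrCA.
Qed.

HB.instance Definition _ c := GRing.isLinear.Build _ _ _ _ (act_fun c)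
  (act_fun_linear c).

Definition act (c : R[i]) : 'End(V) := linfun (act_fun c).

Lemma act_zpow c j : (j < 2 * n)%N -> act c (zpow j) = c ^- j *: zpow j.
Proof.
move=> ltj; have zc i : (zpow j : {poly R[i]})`_i = (i == j)%:R.
  rewrite /zpow /in_qpoly /= /mk_monic size_polyXn ltnS muln_gt0 /=.
  rewrite monicXn andbT; have n0 : (0 < n)%N by case: (n) ltj.
  by rewrite n0 Pdiv.Ring.rmodp_small ?coefXn // !size_polyXn.
rewrite lfunE /= /act_fun.
rewrite (bigD1 (Ordinal ltj)) //= zc eqxx mulr1 big1 ?addr0 // => i.
by rewrite zc -val_eqE /= => /negPf ->; rewrite mulr0 scale0r.
Qed.

Definition tangent_act (W U : {vspace V}) (c : R[i]) :=
  @hom_act _ _ W U (act c).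

Variable lam : n.-tuple nat.

(* With [i] starting from 0, this is the order 2n - l_(i+1) - (i+1). *)
Definition schubert_ord (i : 'I_n) : nat := (2 * n - tnth lam i - i.+1)%N.

Definition Sch : set {vspace V} :=
  [set W | Gr n W /\
     ord_van @` [set w | w \in W /\ w != 0] = range schubert_ord].

Definition W_fix : {vspace V} := <<[seq zpow (schubert_ord i) | i : 'I_n]>>%VS.

(* the complement of [W_fix] spanned by the remaining powers of z *)
Definition U_fix : {vspace V} :=
  <<[seq zpow j | j <- iota 0 (2 * n)%N & j \notin codom schubert_ord]>>%VS.

Definition T_Sch : {vspace 'Hom(subvs_of W_fix, subvs_of U_fix)} :=
  tangent_space W_fix U_fix Sch.

End SchubertCell.

Section Hooks.
Variables (n : nat) (lam : n.-tuple nat).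

(* partitions of [n], with nondecreasing parts and padded with zeros *)
Definition is_partition : Prop := sorted leq lam /\ sumn lam = n.

(* [(i, j)] is the box in row [i] and column [j]; as all the parts are at most
   [n], the Young diagram lies in an n x n square. *)
Definition young_diagram : {set 'I_n * 'I_n} :=
  [set u : 'I_n * 'I_n | (u.2 < tnth lam u.1)%N].

(* Rows have nondecreasing lengths, hence the leg of [u] is made of boxes with
   smaller row indices. *)
Definition hook (u : 'I_n * 'I_n) : {set 'I_n * 'I_n} :=
  [set v in young_diagram |
    ((v.1 == u.1) && (u.2 <= v.2)%N) || ((v.2 == u.2) && (v.1 <= u.1)%N)].

Definition hook_length (u : 'I_n * 'I_n) : nat := #|hook u|.

End Hooks.

(* Main.v *)
(* Put m_j = 2n - 1 - j - #{k | l_k <= j} for 0 <= j < n.  The numbers m_j are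
   exactly the exponents below 2n that are not orders s_i of the Schubert cell;
   moreover s_i < m_j if and only if (i, j) is a box of the Young diagram, and
   then m_j - s_i is its hook length.  In the affine chart Hom(W, U) the
   Schubert cell is the linear subspace spanned by the maps sending z^{s_i} to
   z^{m_j}, for (i, j) a box, and such a map has weight s_i - m_j. *)
Require Import Defs.
From HB Require Import structures.
From mathcomp Require Import all_boot all_order all_algebra.
From mathcomp Require Import boolp classical_sets fsbigop reals.
From mathcomp Require Import complex.
From mathcomp Require Import mpoly zify.
Import Order.TTheory GRing.Theory Num.Theory.
Local Open Scope ring_scope.

(** * Zariski tangent spaces of linear subspaces *)

Lemma mderivXU (R : nzRingType) (n : nat) (i j : 'I_n) :
  ('X_j : {mpoly R[n]})^`M(i) = (j == i)%:R.
Proof.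
rewrite mderivX mnm1E; case: eqVneq => [->|_]; last exact: scale0r.
by rewrite -{1}[U_(i)%MM]add0m addmK mpolyX0 scale1r.
Qed.

Lemma mpoly_line (K : fieldType) (n : nat) (x a : 'I_n -> K)
    (p : {mpoly K[n]}) :
  exists r : {poly K},
    (forall t, r.[t] = meval (fun i => x i + t * a i) p) /\
    r^`().[0] = \sum_i meval x (mderiv i p) * a i.
Proof.
pose Q p := exists r : {poly K},
    (forall t, r.[t] = meval (fun i => x i + t * a i) p) /\
    r^`().[0] = \sum_i meval x (mderiv i p) * a i.
have QC c : Q (mpolyC n c).
  exists c%:P; split=> [t|]; first by rewrite hornerC mevalC.
  rewrite derivC horner0 big1 // => i _.
  by rewrite mderivC meval0 mul0r.
have QD p1 p2 : Q p1 -> Q p2 -> Q (p1 + p2).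
  move=> [r1 [h1 d1]] [r2 [h2 d2]]; exists (r1 + r2); split=> [t|].
    by rewrite hornerD h1 h2 mevalD.
  rewrite derivD hornerD d1 d2 -big_split; apply: eq_bigr => i _.
  by rewrite mderivD mevalD mulrDl.
have QM p1 p2 : Q p1 -> Q p2 -> Q (p1 * p2).
  move=> [r1 [h1 d1]] [r2 [h2 d2]]; exists (r1 * r2); split=> [t|].
    by rewrite hornerM h1 h2 mevalM.
  have x0 : (fun i => x i + 0 * a i) = x.
    by apply: funext => i; rewrite mul0r addr0.
  rewrite derivM hornerD !hornerM d1 d2 h1 h2 x0 mulr_suml mulr_sumr -big_split.
  apply: eq_bigr => i _.
  by rewrite mderivM mevalD !mevalM mulrDl mulrA mulrAC.
have QX i : Q ('X_i).
  exists ((x i)%:P + a i *: 'X); split=> [t|].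
    by rewrite mevalXU !hornerE mulrC.
  rewrite derivD derivC derivZ derivX add0r hornerZ hornerC mulr1.
  rewrite (bigD1 i) //= big1 ?addr0 => [|j ji].
    by rewrite mderivXU eqxx meval1 mul1r.
  by rewrite mderivXU eq_sym (negPf ji) meval0 mul0r.
have Q1 : Q 1 by rewrite -mpolyC1.
rewrite -/(Q p); elim/mpolyind: p => [|c m p _ _ Qp].
  by rewrite -mpolyC0.
apply: (QD) Qp; rewrite -mul_mpolyC; apply: (QM) => //.
rewrite mpolyXE_id; apply: (big_ind Q) => // i _.
by elim: (fun_of_multinom m i) => [|k IH]; rewrite ?expr0 // exprS; apply: (QM).
Qed.

Lemma zariski_tangent_subspace (K : numFieldType) (E : vectType K)
    (L : {vspace E}) :
  zariski_tangent [set v | v \in L]%classic 0 = [set v | v \in L]%classic.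
Proof.
apply/seteqP; split=> [v Tv|v vL p pL] /=.
- apply: contrapT => vL.
  have nz : v - projv L v != 0.
    apply: contra_notN vL; rewrite subr_eq0 => /eqP ->; exact: memv_proj.
  have [k ck] : exists k, coords (v - projv L v) k != 0.
    apply: contrapT => /forallNP h; move: nz.
    rewrite (coord_vbasis (memvf (v - projv L v))) big1 ?eqxx // => i _.
    by have /negP/negPn/eqP := h i; rewrite /coords => ->; rewrite scale0r.
  pose f y := coords (y - projv L y) k.
  have fE y : f y = \sum_(i < \dim {:E}) f ((vbasis {:E})`_i) * coords y i.
    rewrite {1}/f; have -> : y - projv L y = \sum_(i < \dim {:E})
        coords y i *: ((vbasis {:E})`_i - projv L (vbasis {:E})`_i).
      rewrite {1 2}(coord_vbasis (memvf y)) linear_sum -sumrB.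
      by apply: eq_bigr => i _; rewrite linearZ -scalerBr.
    rewrite {1}/coords linear_sum.
    by apply: eq_bigr => i _; rewrite linearZ mulrC.
  pose p : {mpoly K[\dim {:E}]} :=
    \sum_(i < \dim {:E}) f ((vbasis {:E})`_i) *: 'X_i.
  have pE w : meval w p = \sum_(i < \dim {:E}) f ((vbasis {:E})`_i) * w i.
    rewrite /p; elim/big_ind2: _ => [|p1 a1 p2 a2 <- <-|i _].
    - by rewrite meval0.
    - by rewrite mevalD.
    - by rewrite mevalZ mevalXU.
  have /Tv : forall y, y \in L -> meval (coords y) p = 0.
    move=> y yL; rewrite pE -fE /f projv_id // subrr /coords linear0 //.
  have dp i w : meval w (mderiv i p) = f ((vbasis {:E})`_i).
    have -> : f ((vbasis {:E})`_i) =
        \sum_(j < \dim {:E}) f ((vbasis {:E})`_j) * (j == i)%:R.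
      rewrite (bigD1 i) //= eqxx mulr1 big1 ?addr0 // => j /negPf ->.
      by rewrite mulr0.
    rewrite /p; elim/big_ind2: _ => [|p1 a1 p2 a2 <- <-|j _].
    - by rewrite mderiv0 meval0.
    - by rewrite mderivD mevalD.
    rewrite mderivZ mderivXU mevalZ.
    by case: eqP => _; rewrite ?meval1 ?meval0.
  under eq_bigr do rewrite dp.
  by rewrite -fE; apply/eqP.
- have [r [rE <-]] := mpoly_line K _ (coords 0) (coords v) p.
  (* p vanishes on the whole line through v, and K is infinite. *)
  suff -> : r = 0 by rewrite derivC horner0.
  apply/eqP; apply: contraT => r0.
  pose s := [seq i%:R : K | i <- iota 0 (size r)].
  have : (size s < size r)%N.
    apply: max_poly_roots => //.
      apply/allP => t _; rewrite /root rE.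
      have -> : (fun i => coords 0 i + t * coords v i) = coords (t *: v).
        by apply: funext => i; rewrite /coords linear0 add0r linearZ.
      by rewrite pL //= memvZ.
    by rewrite map_inj_uniq ?iota_uniq // => i j /eqP; rewrite eqr_nat => /eqP.
  by rewrite size_map size_iota ltnn.
Qed.

Lemma tangent_space_linear (K : numFieldType) (V : vectType K)
    (W U : {vspace V}) (X : set {vspace V})
    (L : {vspace 'Hom(subvs_of W, subvs_of U)}) :
  (forall phi, X (graph phi) <-> phi \in L) -> tangent_space W U X = L.
Proof.
move=> XL; rewrite /tangent_space.
have -> : [set phi | X (graph phi)]%classic = [set phi | phi \in L]%classic.
  by apply/seteqP; split=> phi /XL.
rewrite zariski_tangent_subspace; apply/vspaceP => phi; apply/idP/idP.
  by move/(mem_vspace_of (P := [set phi | phi \in L]%classic)); apply;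
    rewrite /= ?mem0v // => a u v uL vL; rewrite memvD ?memvZ.
by move=> h; apply/(mem_vspace_of (P := [set phi | phi \in L]%classic));
    rewrite /= ?mem0v // => a u v uL vL; rewrite memvD ?memvZ.
Qed.

(** * Characters from eigenbases *)

Lemma exprz2_inj (K : numFieldType) : injective (exprz (2%:R : K)).
Proof.
move=> i j; rewrite -(ratr_nat K 2) -!fmorphXz => /fmorph_inj.
by apply: ieexprIz.
Qed.

Section EigenbasisCharacter.
Variables (K : numFieldType) (E : vectType K) (I : finType) (e : I -> E).

Lemma mem_span_image (A : {pred I}) v :
  v \in <<[seq e u | u in A]>>%VS <-> exists x, v = \sum_(u in A) x u *: e u.
Proof.
rewrite span_def big_image /=; split=> [/memv_sumP[vs vsP ->]|[x ->]].
  have /choice[x xE] : forall u, exists k, u \in A -> vs u = k *: e u.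
    move=> u; case: (boolP (u \in A)) => uA; last by exists 0.
    by have /vlineP[k ->] := vsP u uA; exists k.
  by exists x; apply: eq_bigr.
by apply: memv_sumr => u _; apply: memvZ; apply: memv_line.
Qed.

Hypothesis e_free : forall x : I -> K, \sum_u x u *: e u = 0 -> x =1 fun=> 0.

Lemma dim_span_image (A : {pred I}) : \dim <<[seq e u | u in A]>> = #|A|.
Proof.
suff : free (image_tuple e (mem A)).
  by move=> /eqP ->; rewrite size_image.
apply/freeP => k sum0 i.
have {}sum0 : \sum_(j < #|A|) k j *: e (enum_val j) = 0.
  by rewrite -[RHS]sum0; apply: eq_bigr => j _; rewrite nth_image.
pose x u := \sum_(j | enum_val j == u) k j.
have /e_free/(_ (enum_val i)) : \sum_u x u *: e u = 0.
  rewrite -[RHS]sum0 (partition_big enum_val predT) //=.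
  apply: eq_bigr => u _; rewrite scaler_suml.
  by apply: eq_bigr => j /eqP <-.
rewrite /x (eq_bigl (pred1 i)) ?big_pred1_eq // => j.
by rewrite (inj_eq enum_val_inj).
Qed.

Variables (rho : K -> E -> E) (w : I -> int).
Hypothesis rho_linear : forall c, linear (rho c).
Hypothesis rho_e : forall c u, c != 0 -> rho c (e u) = c ^ w u *: e u.

Lemma rho_sum c (A : {set I}) (x : I -> K) : c != 0 ->
  rho c (\sum_(u in A) x u *: e u) = \sum_(u in A) (x u * c ^ w u) *: e u.
Proof.
move=> c0.
pose g := GRing.isLinear.Build _ _ _ _ (rho c) (rho_linear c).
pose F : {linear E -> E} := HB.pack (rho c) g.
rewrite -[rho c _]/(F _) linear_sum; apply: eq_bigr => u _.
by rewrite linearZ /= rho_e // scalerA.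
Qed.

Lemma weight_space_span (A : {set I}) (k : int) :
  weight_space <<[seq e u | u in A]>> rho k =
  <<[seq e u | u in [set u in A | w u == k]]>>%VS.
Proof.
apply/vspaceP => v; apply/idP/idP.
- move/(mem_weight_space _ _ rho_linear) => [/mem_span_image[x ->] vk].
  apply/mem_span_image; exists x.
  have e2 : 2%:R != 0 :> K by rewrite pnatr_eq0.
  have := vk _ e2; rewrite rho_sum // scaler_sumr => /eqP.
  rewrite -subr_eq0 -sumrB => /eqP h.
  have sum0 : \sum_u
      (if u \in A then x u * (2%:R ^ w u - 2%:R ^ k) else 0) *: e u = 0.
    rewrite -[RHS]h [RHS]big_mkcond; apply: eq_bigr => u _.
    case: ifP => _; last exact: scale0r.
    by rewrite scalerA -scalerBl mulrBr [_ ^ k * _]mulrC.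
  have xw u : u \in A -> w u != k -> x u = 0.
    move=> uA wk; have := e_free _ sum0 u; rewrite uA => /eqP.
    rewrite mulf_eq0 subr_eq0 => /orP[/eqP //|/eqP e'].
    by move: wk; rewrite (exprz2_inj _ _ _ e') eqxx.
  rewrite big_mkcond [RHS]big_mkcond; apply: eq_bigr => u _.
  rewrite inE; case: ifP => //= uA; case: eqP => // /eqP /(xw u uA) ->.
  exact: scale0r.
- move/mem_span_image => [x ->].
  apply/(mem_weight_space _ _ rho_linear); split.
    apply: memv_suml => u; rewrite inE => /andP[uA _].
    apply: memvZ; apply: memv_span; exact: fintype.image_f.
  move=> c c0; rewrite rho_sum // scaler_sumr; apply: eq_bigr => u.
  by rewrite inE => /andP[_ /eqP ->]; rewrite scalerA mulrC.
Qed.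

Lemma ch_span (A : {set I}) :
  ch <<[seq e u | u in A]>> rho = \sum_(u in A) q ^ w u.
Proof.
rewrite /ch.
under eq_fsbigr do rewrite weight_space_span dim_span_image.
rewrite (fsbigE (undup [seq w u | u in A])) ?undup_uniq //; last first.
  move=> k _; rewrite mem_undup => kA.
  rewrite (_ : [set u in A | w u == k] = finset.set0) ?cards0 //.
  apply/setP => u; rewrite !inE; apply/negP => /andP[uA /eqP wk].
  by case/negP: kA; rewrite -wk; apply: fintype.image_f.
rewrite (eq_bigl predT) => [|k]; last by rewrite mem_set.
rewrite (eq_bigr (fun k => \sum_(u in A | w u == k) q ^ w u)) => [|k _].
  rewrite (exchange_big_dep (mem A)) /=; last by move=> i u _ /andP[].
  apply: eq_bigr => u uA.
  rewrite (eq_bigl (pred1 (w u))) => [|k]; last by rewrite uA eq_sym.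
  rewrite -big_filter filter_pred1_uniq ?undup_uniq ?big_seq1 //.
  by rewrite mem_undup fintype.image_f.
rewrite -sum1_card -sumrMnr (eq_bigl (fun u => (u \in A) && (w u == k))).
  by apply: eq_bigr => u /andP[_ /eqP ->].
by move=> u; rewrite inE.
Qed.
End EigenbasisCharacter.

(** * Hook lengths and Schubert orders *)

Lemma card_ord_lt (n b : nat) : (b <= n)%N -> #|[set k : 'I_n | (k < b)%N]| = b.
Proof.
move=> le_bn; rewrite -[RHS](card_ord b).
have inj_w : injective (widen_ord le_bn).
  by move=> i k /(congr1 val) /= /val_inj.
rewrite -(card_imset _ inj_w); apply: eq_card => k.
rewrite inE; apply/idP/finset.imsetP => [lt_kb|[i _ ->]]; last exact: (ltn_ord i).
by exists (Ordinal lt_kb) => //; apply: val_inj.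
Qed.

Lemma card_ord_interval (n a b : nat) : (b <= n)%N ->
  #|[set k : 'I_n | (a <= k < b)%N]| = (b - a)%N.
Proof.
move=> le_bn; case: (leqP a b) => [le_ab|lt_ba]; last first.
  rewrite (_ : (b - a)%N = 0%N); last by lia.
  by apply/eqP; rewrite cards_eq0; apply/eqP/setP => k; rewrite !inE; lia.
rewrite -{2}(card_ord_lt n b) // -{2}(card_ord_lt n a) ?(leq_trans le_ab) //.
rewrite (_ : [set k : 'I_n | (a <= k < b)%N] =
  [set k : 'I_n | (k < b)%N] :\: [set k : 'I_n | (k < a)%N]).
  rewrite cardsD (finset.setIidPr _) //.
  by apply/fintype.subsetP => k; rewrite !inE; lia.
by apply/setP => k; rewrite !inE -leqNgt.
Qed.

Section SchubertOrders.
Variables (n : nat) (lam : n.-tuple nat).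
Hypothesis lam_part : is_partition lam.

Definition short_rows (j : nat) : {set 'I_n} := [set k | (tnth lam k <= j)%N].

Definition gap_ord (j : 'I_n) : nat := (2 * n - j.+1 - #|short_rows j|)%N.

Lemma leq_part (i k : 'I_n) : (i <= k)%N -> (tnth lam i <= tnth lam k)%N.
Proof.
move=> le_ik; rewrite !(tnth_nth 0%N).
apply: (sorted_leq_nth leq_trans leqnn); rewrite ?inE ?size_tuple //.
by case: lam_part.
Qed.

Lemma part_leq i : (tnth lam i <= n)%N.
Proof.
case: lam_part => _ sum_n; rewrite -[leqRHS]sum_n sumnE big_tuple.
by rewrite (bigD1 i) //= leq_addr.
Qed.

Lemma short_rows_lt i j : (j < tnth lam i)%N -> (#|short_rows j| <= i)%N.
Proof.
move=> lt_j; have <- : #|[set k : 'I_n | (k < i)%N]| = i.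
  by rewrite card_ord_lt // ltnW.
apply/subset_leq_card/fintype.subsetP => k; rewrite !inE => lek /=.
rewrite ltnNge; apply/negP => /leq_part; lia.
Qed.

Lemma short_rows_gt i j : (tnth lam i <= j)%N -> (i < #|short_rows j|)%N.
Proof.
move=> lej; have {1}<- : #|[set k : 'I_n | (k < i.+1)%N]| = i.+1.
  by rewrite card_ord_lt.
apply/subset_leq_card/fintype.subsetP => k; rewrite !inE /= ltnS => /leq_part.
lia.
Qed.

Lemma card_short_rows j : (#|short_rows j| <= n)%N.
Proof. by rewrite -[n in leqRHS]card_ord max_card. Qed.

Lemma schubert_ord_lt i : (schubert_ord lam i < 2 * n)%N.
Proof. by rewrite /schubert_ord; have := ltn_ord i; have := part_leq i; lia. Qed.

Lemma gap_ord_lt j : (gap_ord j < 2 * n)%N.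
Proof. by rewrite /gap_ord; have := ltn_ord j; lia. Qed.

Lemma schubert_ord_inj : injective (schubert_ord lam).
Proof.
move=> i k; rewrite /schubert_ord => e; apply: ord_inj.
have := ltn_ord i; have := ltn_ord k; have := part_leq i; have := part_leq k.
by case: (leqP i k) => [le_ik|/ltnW le_ki];
  [have := leq_part i k le_ik|have := leq_part k i le_ki]; lia.
Qed.

Lemma gap_ord_inj : injective gap_ord.
Proof.
move=> i j; rewrite /gap_ord => e; apply: ord_inj.
have := ltn_ord i; have := ltn_ord j.
have := card_short_rows i; have := card_short_rows j.
have mono a b : (a <= b)%N -> (#|short_rows a| <= #|short_rows b|)%N.
  move=> le_ab; apply/subset_leq_card/fintype.subsetP => k.
  by rewrite !inE => /leq_trans; apply.
by case: (leqP i j) => [le_ij|/ltnW le_ji];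
  [have := mono i j le_ij|have := mono j i le_ji]; lia.
Qed.

Lemma schubert_lt_gap i j :
  (schubert_ord lam i < gap_ord j)%N = (j < tnth lam i)%N.
Proof.
rewrite /schubert_ord /gap_ord.
have := ltn_ord i; have := ltn_ord j; have := part_leq i.
have := card_short_rows j.
case: (ltnP j (tnth lam i)) => lt_j.
  by have := short_rows_lt i j lt_j; lia.
by have := short_rows_gt i j lt_j; lia.
Qed.

Lemma gap_lt_schubert i j :
  (gap_ord j < schubert_ord lam i)%N = (tnth lam i <= j)%N.
Proof.
rewrite /schubert_ord /gap_ord.
have := ltn_ord i; have := ltn_ord j; have := part_leq i.
have := card_short_rows j.
case: (ltnP j (tnth lam i)) => lt_j.
  by have := short_rows_lt i j lt_j; lia.
by have := short_rows_gt i j lt_j; lia.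
Qed.

Lemma schubert_neq_gap i j : (schubert_ord lam i == gap_ord j) = false.
Proof.
apply/negP => /eqP e; have := schubert_lt_gap i j; have := gap_lt_schubert i j.
by rewrite e ltnn leqNgt => /esym/negPn ->.
Qed.

Lemma schubert_or_gap t : (t < 2 * n)%N ->
  (exists i, t = schubert_ord lam i) \/ (exists j, t = gap_ord j).
Proof.
move=> lt_t.
pose f (x : 'I_n + 'I_n) : 'I_(2 * n) := match x with
  | inl i => Ordinal (schubert_ord_lt i) | inr j => Ordinal (gap_ord_lt j) end.
have finj : injective f.
  move=> [i|j] [k|l] /(congr1 val) /= e.
  - by rewrite (schubert_ord_inj _ _ e).
  - by have := schubert_neq_gap i l; rewrite e eqxx.
  - by have := schubert_neq_gap k j; rewrite e eqxx.
  - by rewrite (gap_ord_inj _ _ e).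
have : Ordinal lt_t \in codom f.
  by apply: inj_card_onto; rewrite // card_sum !card_ord addnn mul2n.
move=> /codomP[[i|j] /(congr1 val) /= ->]; [left; by exists i|right; by exists j].
Qed.

Lemma hook_lengthE (u : 'I_n * 'I_n) : u \in young_diagram lam ->
  hook_length lam u = (gap_ord u.2 - schubert_ord lam u.1)%N.
Proof.
case: u => i j; rewrite inE /= => lt_j.
pose arm : {set 'I_n} := [set k : 'I_n | (j <= k < tnth lam i)%N].
pose leg : {set 'I_n} := [set k : 'I_n | (k < i)%N] :\: short_rows j.
have -> : hook_length lam (i, j) = (#|arm| + #|leg|)%N.
  have -> : #|arm| = #|[set (i, k) | k in arm]|.
    by rewrite card_imset // => a b [].
  have -> : #|leg| = #|[set (k, j) | k in leg]|.
    by rewrite card_imset // => a b [].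
  have dis : [disjoint [set (i, k) | k in arm] & [set (k, j) | k in leg]].
    apply/pred0P => -[a b] /=; apply/negP => /andP[].
    move=> /finset.imsetP[k _ [-> _]] /finset.imsetP[l + [e _]].
    by rewrite -e !inE ltnn andbF.
  move: dis; rewrite -leq_card_setU => /eqP <-.
  apply: eq_card => -[a b]; rewrite !inE /=.
  apply/idP/orP.
    move=> /andP[lt_b /orP[/andP[/eqP e le_jb]|/andP[/eqP e le_ai]]].
      by left; apply/finset.imsetP; exists b; rewrite ?e // inE le_jb -e.
    have [eai|nai] := eqVneq a i.
      left; apply/finset.imsetP; exists b; rewrite ?eai //.
      by rewrite inE e leqnn /= -e -eai.
    right; apply/finset.imsetP; exists a; rewrite ?e // !inE -e -ltnNge lt_b /=.
    by rewrite ltn_neqAle nai.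
  case=> /finset.imsetP[k + [-> ->]]; rewrite !inE eqxx /=.
    by move=> /andP[-> ->].
  by rewrite -ltnNge => /andP[-> /ltnW ->]; rewrite orbT.
have -> : #|arm| = (tnth lam i - j)%N by rewrite card_ord_interval ?part_leq.
have -> : #|leg| = (i - #|short_rows j|)%N.
  rewrite cardsD card_ord_lt 1?ltnW //; congr (_ - _)%N.
  apply: eq_card => k; rewrite !inE; apply: andb_idl => le_k.
  by rewrite ltnNge; apply/negP => /leq_part; lia.
have := ltn_ord i; have := ltn_ord j; have := part_leq i.
have := card_short_rows j; have := short_rows_lt i j lt_j.
by rewrite /gap_ord /schubert_ord /=; lia.
Qed.

End SchubertOrders.

(** * The Schubert cell in the affine chart *)

Lemma hom_act_val (K : fieldType) (V : vectType K) (W U : {vspace V})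
    (g : 'End(V)) (phi : 'Hom(subvs_of W, subvs_of U)) (x y : subvs_of W) :
  (W :&: U = 0)%VS -> lker g == 0%VS -> (g @: U <= U)%VS ->
  vsval x = g (vsval y) -> vsval (hom_act g phi x) = g (vsval (phi y)).
Proof.
move=> WU kg gU xE.
rewrite /hom_act !comp_lfunE /= !lfunE /= xE lker0_lfunK // vsvalK.
have inU : g (vsval (phi y)) \in U.
  by apply: (subvP gU); rewrite memv_img ?subvsP.
by rewrite daddv_pi_id ?vsprojK // capvC.
Qed.

Section SchubertChart.
Variables (R : realType) (n : nat) (lam : n.-tuple nat).
Hypotheses (n_gt0 : (0 < n)%N) (lam_part : is_partition lam).
Local Notation C := R[i].
Implicit Types (v : V R n) (t : nat).

Definition coefV (v : V R n) (t : nat) : C := (v : {poly C})`_t.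

Lemma coefVD v1 v2 t : coefV (v1 + v2) t = coefV v1 t + coefV v2 t.
Proof. exact: coefD. Qed.

Lemma coefVZ a v t : coefV (a *: v) t = a * coefV v t.
Proof. exact: coefZ. Qed.

Lemma coefV0 t : coefV 0 t = 0.
Proof. exact: coef0. Qed.

Lemma coefV_sum (I : finType) (P : pred I) (F : I -> V R n) t :
  coefV (\sum_(i | P i) F i) t = \sum_(i | P i) coefV (F i) t.
Proof. by apply: (big_morph (coefV^~ t)) => [u v|]; rewrite ?coefVD ?coefV0. Qed.

Lemma coefV_default v t : (2 * n <= t)%N -> coefV v t = 0.
Proof.
move=> le_t; apply: big_coef_npoly.
by rewrite /mk_monic size_polyXn ltnS muln_gt0 n_gt0 monicXn /= size_polyXn.
Qed.

Lemma V_ext v1 v2 :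
  (forall t, (t < 2 * n)%N -> coefV v1 t = coefV v2 t) -> v1 = v2.
Proof.
move=> eq_coef; apply/val_inj/polyP => t.
case: (ltnP t (2 * n)) => [/eq_coef //|le_t].
by rewrite -!/(coefV _ t) !coefV_default.
Qed.

Lemma coefV_zpow j t : (j < 2 * n)%N -> coefV (zpow R n j) t = (t == j)%:R.
Proof.
move=> ltj; rewrite /coefV /zpow /in_qpoly /= /mk_monic size_polyXn ltnS.
rewrite muln_gt0 n_gt0 /=.
by rewrite monicXn Pdiv.Ring.rmodp_small ?coefXn // !size_polyXn.
Qed.

Lemma coefV_act c v t :
  (t < 2 * n)%N -> coefV (@act R n c v) t = c ^- t * coefV v t.
Proof.
move=> lt_t; rewrite lfunE /= /act_fun coefV_sum (bigD1 (Ordinal lt_t)) //=.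
rewrite coefVZ coefV_zpow // eqxx mulr1 big1 ?addr0 // => i ne_i.
rewrite coefVZ coefV_zpow //; case: eqP => [e|]; last by rewrite mulr0.
by case/eqP: ne_i; apply: val_inj.
Qed.

Lemma actK c : c != 0 -> cancel (@act R n c) (@act R n c^-1).
Proof.
move=> c0 v; apply: V_ext => t lt_t; rewrite !coefV_act // mulrA.
by rewrite exprVn invrK mulfV ?mul1r // expf_neq0.
Qed.

Lemma mem_span_zpow (s : seq nat) v : {subset s <= gtn (2 * n)} ->
  v \in <<map (zpow R n) s>>%VS <-> forall t, t \notin s -> coefV v t = 0.
Proof.
move=> s_lt; split.
  elim: s s_lt v => [|j s IH] s_lt v.
    by rewrite span_nil memv0 => /eqP -> t _; rewrite coefV0.
  have ltj : (j < 2 * n)%N by apply: s_lt; rewrite mem_head.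
  rewrite span_cons => /memv_addP[_ /vlineP[k ->] [u us ->]] t.
  rewrite inE negb_or => /andP[tj ts].
  rewrite coefVD coefVZ coefV_zpow // (negPf tj) mulr0 add0r.
  by apply: IH => // i si; apply: s_lt; rewrite inE si orbT.
move=> v0; have -> : v = \sum_(i < 2 * n) coefV v i *: zpow R n i.
  apply: V_ext => t lt_t; rewrite coefV_sum (bigD1 (Ordinal lt_t)) //=.
  rewrite coefVZ coefV_zpow // eqxx mulr1 big1 ?addr0 // => i ne_i.
  rewrite coefVZ coefV_zpow //; case: eqP => [e|]; last by rewrite mulr0.
  by case/eqP: ne_i; apply: val_inj.
apply: memv_suml => i _; case: (boolP (val i \in s)) => [si|/v0 ->].
  by apply: memvZ; apply: memv_span; apply: map_f.
by rewrite scale0r mem0v.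
Qed.

Lemma ord_van_eq v k : coefV v k != 0 ->
  (forall t, (t < k)%N -> coefV v t = 0) -> ord_van v = k.
Proof.
move=> vk v0; set p : {poly C} := v.
have pE : p = 'X^k * drop_poly k p.
  rewrite -{1}(poly_take_drop k p) mulrC.
  suff -> : take_poly k p = 0 by rewrite add0r.
  apply/polyP => t; rewrite coef_take_poly coef0.
  by case: ifP => // /v0.
have nr : ~~ root (drop_poly k p) 0.
  by rewrite /root horner_coef0 coef_drop_poly.
rewrite /ord_van -/p pE mupMl // -['X]subr0 -[X in mup X]/(0 : C).
by rewrite mup_XsubCX eqxx.
Qed.

Lemma ord_van_ex v : v != 0 -> exists2 k, coefV v k != 0 &
  forall t, (t < k)%N -> coefV v t = 0.
Proof.
move=> v0; have ex_k : exists k, coefV v k != 0.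
  apply: contrapT => /forallNP h; case/eqP: v0; apply: V_ext => t _.
  by rewrite coefV0; apply/eqP/negPn/negP.
case: (ex_minnP ex_k) => k vk min_k; exists k => // t lt_t.
by apply/eqP; apply: contraT => /min_k; rewrite leqNgt lt_t.
Qed.

Local Notation W := (W_fix R lam).
Local Notation U := (U_fix R lam).
Local Notation s := (schubert_ord lam).
Local Notation m := (gap_ord n lam).

Lemma mem_W_fix v : v \in W <-> forall j, coefV v (m j) = 0.
Proof.
rewrite /W_fix /image_mem (map_comp (zpow R n) s).
rewrite mem_span_zpow => [|t]; last first.
  by move=> /mapP[i _ ->]; apply: schubert_ord_lt.
split=> [v0 j|v0 t tS].
  apply: v0; apply/negP => /mapP[i _ /esym/eqP].
  by rewrite schubert_neq_gap.
case: (ltnP t (2 * n)) => [/(schubert_or_gap n lam lam_part)|/coefV_default //].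
case=> [[i te]|[j ->]] //; case/negP: tS; rewrite te.
by apply: map_f; rewrite mem_enum.
Qed.

Lemma mem_U_fix v : v \in U <-> forall i, coefV v (s i) = 0.
Proof.
rewrite /U_fix mem_span_zpow => [|t]; last first.
  by rewrite mem_filter mem_iota add0n => /andP[_ /andP[]].
split=> [v0 i|v0 t].
  by apply: v0; rewrite mem_filter codom_f.
rewrite mem_filter mem_iota add0n leq0n /= => tU.
case: (ltnP t (2 * n)) => [lt_t|/coefV_default //].
move: tU; rewrite lt_t andbT negbK => /codomP[i ->]; exact: v0.
Qed.

Lemma W_fix_U_fix_eq0 : (W :&: U)%VS = 0%VS.
Proof.
apply/eqP; rewrite -subv0; apply/subvP => v.
rewrite memv_cap memv0 => /andP[/mem_W_fix vW /mem_U_fix vU].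
apply/eqP/V_ext => t /(schubert_or_gap n lam lam_part).
by rewrite coefV0 => -[[i ->]|[j ->]].
Qed.

Lemma zpow_in_W_fix i : zpow R n (s i) \in W.
Proof.
apply/mem_W_fix => j; rewrite coefV_zpow; last exact: schubert_ord_lt.
by rewrite eq_sym schubert_neq_gap.
Qed.

Lemma zpow_in_U_fix j : zpow R n (m j) \in U.
Proof.
apply/mem_U_fix => i; rewrite coefV_zpow; last exact: gap_ord_lt.
by rewrite schubert_neq_gap.
Qed.

Definition zW i : subvs_of W := vsproj W (zpow R n (s i)).
Definition zU j : subvs_of U := vsproj U (zpow R n (m j)).

Lemma coefV_zW i k : coefV (vsval (zW i)) (s k) = (k == i)%:R.
Proof.
rewrite vsprojK ?zpow_in_W_fix // coefV_zpow; last exact: schubert_ord_lt.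
by rewrite (inj_eq (schubert_ord_inj n lam lam_part)).
Qed.

Lemma coefV_zU j k : coefV (vsval (zU j)) (m k) = (k == j)%:R.
Proof.
rewrite vsprojK ?zpow_in_U_fix // coefV_zpow; last exact: gap_ord_lt.
by rewrite (inj_eq (gap_ord_inj n lam)).
Qed.

Definition matrix_unit_fun (u : 'I_n * 'I_n) (x : subvs_of W) : subvs_of U :=
  coefV (vsval x) (s u.1) *: zU u.2.

Lemma matrix_unit_fun_linear u : linear (matrix_unit_fun u).
Proof.
move=> a x y; rewrite /matrix_unit_fun linearP coefVD coefVZ.
by rewrite scalerDl scalerA.
Qed.

HB.instance Definition _ u := GRing.isLinear.Build _ _ _ _
  (matrix_unit_fun u) (matrix_unit_fun_linear u).

Definition matrix_unit u : 'Hom(subvs_of W, subvs_of U) :=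
  linfun (matrix_unit_fun u).

Definition entry (phi : 'Hom(subvs_of W, subvs_of U)) (u : 'I_n * 'I_n) : C :=
  coefV (vsval (phi (zW u.1))) (m u.2).

Lemma eq_subvs_U (x y : subvs_of U) :
  (forall j, coefV (vsval x) (m j) = coefV (vsval y) (m j)) -> x = y.
Proof.
move=> exy; apply/subvs_inj/V_ext => t /(schubert_or_gap n lam lam_part).
have xU := subvsP x; have yU := subvsP y.
move=> [[i ->]|[j ->]]; last exact: exy.
by rewrite !(mem_U_fix _).1.
Qed.

Lemma subvs_W_sum (x : subvs_of W) : x = \sum_i coefV (vsval x) (s i) *: zW i.
Proof.
apply/subvs_inj/V_ext => t /(schubert_or_gap n lam lam_part).
move=> [[i ->]|[j ->]]; last by rewrite !(mem_W_fix _).1 ?subvsP.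
rewrite linear_sum coefV_sum (bigD1 i) //= coefVZ coefV_zW eqxx mulr1.
rewrite big1 ?addr0 // => k ki.
by rewrite coefVZ coefV_zW eq_sym (negPf ki) mulr0.
Qed.

Lemma hom_coefV (phi : 'Hom(subvs_of W, subvs_of U)) x j :
  coefV (vsval (phi x)) (m j) =
  \sum_i coefV (vsval x) (s i) * entry phi (i, j).
Proof.
rewrite {1}(subvs_W_sum x) !linear_sum coefV_sum; apply: eq_bigr => i _.
by rewrite !linearZ coefVZ.
Qed.

Lemma entry_sum (I : finType) (P : pred I) F u :
  entry (\sum_(i | P i) F i) u = \sum_(i | P i) entry (F i) u.
Proof. by rewrite /entry sum_lfunE linear_sum coefV_sum. Qed.

Lemma entryZ a phi u : entry (a *: phi) u = a * entry phi u.
Proof. by rewrite /entry scale_lfunE linearZ coefVZ. Qed.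

Lemma entry_matrix_unit u (v : 'I_n * 'I_n) :
  entry (matrix_unit u) v = (v == u)%:R.
Proof.
rewrite /entry lfunE /= /matrix_unit_fun /= coefVZ coefV_zW coefV_zU.
by case: u v => [i j] [k l] /=; rewrite xpair_eqE [i == k]eq_sym -natrM mulnb.
Qed.

Lemma entry_sum_matrix_unit (x : 'I_n * 'I_n -> C) (A : {pred 'I_n * 'I_n}) u :
  entry (\sum_(v in A) x v *: matrix_unit v) u = if u \in A then x u else 0.
Proof.
rewrite entry_sum big_mkcond (bigD1 u) //= big1 ?addr0 => [|v vu].
  by rewrite entryZ entry_matrix_unit eqxx mulr1.
by rewrite entryZ entry_matrix_unit eq_sym (negPf vu) mulr0 if_same.
Qed.

Lemma eq_entry phi psi : entry phi =1 entry psi -> phi = psi.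
Proof.
move=> e; apply/lfunP => x; apply: eq_subvs_U => j.
by rewrite !hom_coefV; apply: eq_bigr => i _; rewrite e.
Qed.

Lemma matrix_unit_free (x : 'I_n * 'I_n -> C) :
  \sum_u x u *: matrix_unit u = 0 -> x =1 fun=> 0.
Proof.
move=> /(congr1 (fun phi => entry phi)) e u.
have := entry_sum_matrix_unit x predT u; rewrite inE /= => <-.
by rewrite e /entry zero_lfunE linear0 coefV0.
Qed.

Lemma mem_span_matrix_unit (A : {set 'I_n * 'I_n}) phi :
  phi \in <<[seq matrix_unit u | u in A]>>%VS <->
  forall u, u \notin A -> entry phi u = 0.
Proof.
rewrite mem_span_image; split=> [[x ->] u uA|phi0].
  by rewrite (entry_sum_matrix_unit x (mem A)) (negPf uA).
exists (entry phi); apply: eq_entry => u.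
by rewrite (entry_sum_matrix_unit (entry phi) (mem A)); case: ifPn => // /phi0.
Qed.

Lemma tangent_act_matrix_unit c u : c != 0 ->
  tangent_act c (matrix_unit u) =
  c ^ ((s u.1)%:Z - (m u.2)%:Z) *: matrix_unit u.
Proof.
move=> c0; apply: eq_entry => v; rewrite entryZ.
have eq_zW : vsval (zW v.1) = @act R n c (vsval (c ^+ s v.1 *: zW v.1)).
  rewrite /= vsprojK ?zpow_in_W_fix // linearZ /= act_zpow ?schubert_ord_lt //.
  by rewrite scalerA mulfV ?scale1r // expf_neq0.
have actU : (@act R n c @: U <= U)%VS.
  apply/subvP => _ /memv_imgP[x /mem_U_fix xU ->]; apply/mem_U_fix => i.
  by rewrite coefV_act ?schubert_ord_lt // xU mulr0.
have act0 : lker (@act R n c) == 0%VS.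
  by apply/lker0P; apply: can_inj (actK c c0).
rewrite /entry (hom_act_val _ _ _ _ _ _ _ _ W_fix_U_fix_eq0 act0 actU eq_zW).
rewrite coefV_act ?gap_ord_lt // linearZ coefVZ -/(entry _ v) entry_matrix_unit.
case: eqP => [->|_]; last by rewrite !mulr0.
by rewrite !mulr1 expfzDr // -exprnN mulrC.
Qed.

Definition graph_vec (phi : 'Hom(subvs_of W, subvs_of U)) x :=
  vsval x + vsval (phi x).

Lemma mem_graph (phi : 'Hom(subvs_of W, subvs_of U)) v :
  v \in graph phi <-> exists x, v = graph_vec phi x.
Proof.
have gE x : (linfun vsval + (linfun vsval \o phi))%VF x = graph_vec phi x.
  by rewrite add_lfunE comp_lfunE !lfunE.
split=> [/memv_imgP[x _ ->]|[x ->]]; first by exists x.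
by apply/memv_imgP; exists x; rewrite ?memvf ?gE.
Qed.

Lemma coefV_graph_vec_W phi x i :
  coefV (graph_vec phi x) (s i) = coefV (vsval x) (s i).
Proof. by rewrite coefVD [X in _ + X](mem_U_fix _).1 ?subvsP ?addr0. Qed.

Lemma coefV_graph_vec_U phi x j :
  coefV (graph_vec phi x) (m j) = \sum_i coefV (vsval x) (s i) * entry phi (i, j).
Proof.
by rewrite coefVD [X in X + _](mem_W_fix _).1 ?subvsP // add0r hom_coefV.
Qed.

Lemma dim_graph (phi : 'Hom(subvs_of W, subvs_of U)) : \dim (graph phi) = n.
Proof.
have -> : graph phi = <<[seq graph_vec phi (zW i) | i in 'I_n]>>%VS.
  have gv_sum (x : 'I_n -> C) : graph_vec phi (\sum_i x i *: zW i) =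
      \sum_i x i *: graph_vec phi (zW i).
    rewrite /graph_vec !linear_sum -big_split; apply: eq_bigr => i _.
    by rewrite !linearZ scalerDr.
  apply/vspaceP => v; apply/idP/idP.
    move=> /mem_graph[x ->]; apply/mem_span_image.
    by exists (fun i => coefV (vsval x) (s i)); rewrite -gv_sum -subvs_W_sum.
  move=> /mem_span_image[x ->]; apply/mem_graph.
  by exists (\sum_i x i *: zW i); rewrite gv_sum.
rewrite dim_span_image ?card_ord // => x /(congr1 (coefV^~ (s _))) x0 i.
have := x0 i; rewrite coefV0 coefV_sum (bigD1 i) //= coefVZ coefV_graph_vec_W.
rewrite coefV_zW eqxx mulr1 big1 ?addr0 // => k ki.
by rewrite coefVZ coefV_graph_vec_W coefV_zW eq_sym (negPf ki) mulr0.
Qed.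

Lemma Sch_graph (phi : 'Hom(subvs_of W, subvs_of U)) :
  @Sch R n lam (graph phi) <->
  forall u, u \notin young_diagram lam -> entry phi u = 0.
Proof.
split=> [[_ orders] [i j]|phi0].
- rewrite inE /= -leqNgt -gap_lt_schubert // => lt_ms.
  pose v := graph_vec phi (zW i).
  have vs k : coefV v (s k) = (k == i)%:R by rewrite coefV_graph_vec_W coefV_zW.
  have v0 : v != 0.
    apply/eqP => v0; have := vs i; rewrite v0 coefV0 eqxx => /esym/eqP.
    by rewrite oner_eq0.
  have [t vt v_lt] := ord_van_ex v v0.
  have : ((@ord_van R n) @` [set w | w \in graph phi /\ w != 0])%classic t.
    exists v; last exact: ord_van_eq.
    by split=> //; apply/mem_graph; exists (zW i).
  rewrite orders => -[k _ tE]; move: vt v_lt; rewrite -tE vs.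
  case: (k =P i) => [->|]; last by rewrite eqxx.
  move=> _ /(_ _ lt_ms); rewrite /v coefV_graph_vec_U (bigD1 i) //=.
  rewrite coefV_zW eqxx mul1r big1 ?addr0 // => l li.
  by rewrite coefV_zW (negPf li) mul0r.
have entry0 i j : (m j < s i)%N -> entry phi (i, j) = 0.
  by move=> lt_ms; apply: phi0; rewrite inE /= -leqNgt -gap_lt_schubert.
have ord_min x i : coefV (vsval x) (s i) != 0 ->
    (forall k, (s k < s i)%N -> coefV (vsval x) (s k) = 0) ->
    ord_van (graph_vec phi x) = s i.
  move=> xi x_lt; apply: ord_van_eq; first by rewrite coefV_graph_vec_W.
  move=> t lt_t; have : (t < 2 * n)%N.
    by apply: ltn_trans lt_t _; apply: schubert_ord_lt.
  case/(schubert_or_gap n lam lam_part) => [[k te]|[j te]].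
    by rewrite te coefV_graph_vec_W x_lt -?te.
  rewrite te coefV_graph_vec_U big1 // => k _.
  case: (ltnP (s k) (s i)) => [/x_lt ->|le_sk]; first by rewrite mul0r.
  by rewrite entry0 ?mulr0 // -te (leq_trans lt_t).
split; first exact: dim_graph.
apply/seteqP; split=> t /=.
- move=> [v [/mem_graph[x ->] v0] <-].
  have [i0 xi0] : exists i, coefV (vsval x) (s i) != 0.
    apply: contrapT => /forallNP h; case/eqP: v0.
    suff -> : x = 0 by rewrite /graph_vec !linear0 addr0.
    rewrite (subvs_W_sum x) big1 // => i _.
    by have /negP/negPn/eqP -> := h i; rewrite scale0r.
  pose nz i := coefV (vsval x) (s i) != 0.
  case: (@arg_minnP _ i0 nz s xi0) => i xi min_i; exists i => //.
  apply/esym/ord_min => // k lt_k; apply/eqP; apply: contraT => /min_i.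
  by rewrite leqNgt lt_k.
- move=> [i _ <-]; exists (graph_vec phi (zW i)).
    split; first by apply/mem_graph; exists (zW i).
    apply/eqP => /(congr1 (coefV^~ (s i))) /eqP.
    by rewrite coefV_graph_vec_W coefV_zW eqxx coefV0 oner_eq0.
  apply: ord_min => [|k lt_k]; rewrite coefV_zW ?eqxx ?oner_eq0 //.
  by case: eqP lt_k => // ->; rewrite ltnn.
Qed.
End SchubertChart.

Theorem lemma3p2 (R : realType) (n : nat) (n_ge1 : (1 <= n)%N)
    (lam : n.-tuple nat) (lam_part : is_partition lam) :
  ch (T_Sch R lam) (@tangent_act R n (W_fix R lam) (U_fix R lam)) =
  \sum_(u in young_diagram lam) q ^ (- (hook_length lam u)%:Z).
Proof.
rewrite /T_Sch (tangent_space_linear _ _ _ _ _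
  <<[seq matrix_unit R n lam u | u in young_diagram lam]>>%VS) => [|phi].
  rewrite (ch_span _ _ _ _ _ _
    (fun u => (schubert_ord lam u.1)%:Z - (gap_ord n lam u.2)%:Z)).
  - apply: eq_bigr => u uY; rewrite hook_lengthE //; congr (q ^ _).
    move: uY; rewrite inE -schubert_lt_gap // => /ltnW le_sm.
    by rewrite -subzn // opprB.
  - exact: matrix_unit_free.
  - by move=> c; apply: hom_act_linear.
  - by move=> c u c0; apply: tangent_act_matrix_unit.
by rewrite Sch_graph // mem_span_matrix_unit.
Qed.
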